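(* Let $\widehat G=(\widehat V,\widehat E)$ be a finite $d$-regular simple graph with $|\widehat V|=n$, let $G=(V,E)$ be the connected graph obtained from $\widehat G$ by removing $m$ vertices together with all edges adjacent to a removed vertex, and let $K$ and $Q$ be the $\frac12$-lazy simple random walk on $\widehat G$ and the associated Metropolis--Hastings walk on $G$ with uniform stationary distribution (as defined in the context). Fix probability measures $\{P_x\}_{x\in\widehat V}$ on $V$ with $P_x=\delta_x$ for $x\in V$, couplings $\{P_{x,y}\}_{(x,y)\in\widehat E}$ of $P_x$ and $P_y$, and a flow $F$ in $G$. Then for every $f:V\to\mathbb{R}$, the extension $\widehat f(x)=\sum_{y\in V}P_x[y]f(y)$, $x\in\widehat V$, satisfies $$\mathcal{E}_K(\widehat f,\widehat f)\le \frac{n-m}{n}\,\mathcal{A}\,\mathcal{E}_Q(f,f),$$ where $$\mathcal{A}=\sup_{(q,r)\in E}\Big(1+2\sum_{\gamma\ni(q,r)}k[\gamma]F[\gamma]\sum_{y\in\widehat V\setminus V}P_y[o(\gamma)]+\sum_{\gamma\ni(q,r)}F[\gamma]k[\gamma]\sum_{(x,y)\in\widehat E,\;x,y\notin V}P_{x,y}[i(\gamma),o(\gamma)]\Big).$$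
   Context: Edge sets are regarded as symmetric sets of ordered pairs. The kernel $K$ on $\widehat V$: $K(x,x)=\frac12$, $K(x,y)=\frac1{2d}$ if $(x,y)\in\widehat E$, and $K(x,y)=0$ otherwise; its stationary distribution $\mu$ is uniform on $\widehat V$. The kernel $Q$ on $V$: $Q(x,x)=\frac12\left(2-\frac{\deg(x)}{d}\right)$, where $\deg(x)$ is the number of vertices of $G$ adjacent to $x$ in $G$; $Q(x,y)=\frac1{2d}$ if $(x,y)\in E$; and $Q(x,y)=0$ otherwise. Its stationary distribution $\nu$ is uniform on $V$. For a kernel $P$ on a finite set $X$ with stationary distribution $\pi$, $\mathcal{E}_P(f,f)=\frac12\sum_{x,y\in X}|f(x)-f(y)|^2P(x,y)\pi(x)$. Couplings: for each $(x,y)\in\widehat E$, $P_{x,y}$ is a probability measure on $V\times V$ with $\sum_bP_{x,y}[a,b]=P_x[a]$ for all $a\in V$ and $\sum_aP_{x,y}[a,b]=P_y[b]$ for all $b\in V$. A path from $a$ to $b$ in $G$ is a finite sequence $\gamma=(a=v_0,v_1,\dots,v_{k[\gamma]}=b)$ of vertices of $V$ with $(v_i,v_{i+1})\in E$ for $0\le i<k[\gamma]$; $k[\gamma]$ is its length, $i(\gamma)=a$ its initial vertex, $o(\gamma)=b$ its final vertex. $\Gamma_{a,b}$ is the set of all paths from $a$ to $b$. A flow is a function $F$ from paths to $[0,1]$ with $\sum_{\gamma\in\Gamma_{a,b}}F[\gamma]=1$ for all $a,b\in V$. The notation $\gamma\ni(q,r)$ means that $(v_i,v_{i+1})=(q,r)$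 for some $0\le i<k[\gamma]$; the sums over $\gamma\ni(q,r)$ run over all such paths. *)

(* Defs.v *)
From mathcomp Require Import all_boot all_order all_algebra.
From mathcomp Require Import all_classical all_reals all_analysis.

Set Implicit Arguments.
Unset Strict Implicit.
Unset Printing Implicit Defensive.

Import Order.TTheory GRing.Theory Num.Theory.
Local Open Scope classical_set_scope.
Local Open Scope ring_scope.

Definition simple_graph (T : finType) (e : rel T) : Prop :=
  symmetric e /\ irreflexive e.

Definition degree (T : finType) (e : rel T) (x : T) : nat :=
  #|[pred y | e x y]|.

Definition regular_graph (T : finType) (e : rel T) (d : nat) : Prop :=
  forall x, degree e x = d.

Definition connected_graph (T : finType) (e : rel T) : Prop :=
  (0 < #|T|)%N /\ forall x y, connect e x y.

(* The vertex set V of the graph obtained by removing the vertices in [W]. *)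
Definition kept (T : finType) (W : {set T}) : Type := {x : T | x \notin W}.

Definition removal_graph (T : finType) (e : rel T) (W : {set T}) : rel (kept W) :=
  fun x y => e (val x) (val y).
Arguments removal_graph {T} e W _ _.

Definition uniform_pmf (R : realType) (X : finType) : X -> R :=
  fun _ => #|X|%:R^-1.
Arguments uniform_pmf : clear implicits.

Definition lazy_walk (R : realType) (T : finType) (e : rel T) (d : nat) :
    T -> T -> R :=
  fun x y => if x == y then 2^-1
             else if e x y then (2 * d%:R)^-1 else 0.
Arguments lazy_walk R {T} e d.

(* [e] is the graph G obtained after removal; [d] is the degree of the original
   regular graph. *)
Definition metropolis_walk (R : realType) (T : finType) (e : rel T) (d : nat) :
    T -> T -> R :=
  fun x y => if x == y then 2^-1 * (2 - (degree e x)%:R / d%:R)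
             else if e x y then (2 * d%:R)^-1 else 0.
Arguments metropolis_walk R {T} e d.

Definition dirichlet_form (R : realType) (X : finType)
    (P : X -> X -> R) (pi : X -> R) (f : X -> R) : R :=
  2^-1 * \sum_(x : X) \sum_(y : X) `|f x - f y| ^+ 2 * P x y * pi x.

Definition is_pmf (R : realType) (X : finType) (p : X -> R) : Prop :=
  (forall x, 0 <= p x) /\ \sum_(x : X) p x = 1.

Definition is_coupling (R : realType) (X : finType) (p q : X -> R)
    (c : X * X -> R) : Prop :=
  [/\ is_pmf c,
      forall a, \sum_(b : X) c (a, b) = p a
    & forall b, \sum_(a : X) c (a, b) = q b].

(* [(v_0, [:: v_1; ...; v_k])]: vertices may repeat and k = 0 is allowed, so
   this type is in general countably infinite and sums over paths are
   unconditional sums [\esum] in [0, +oo]. *)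
Definition gpath (T : finType) (e : rel T) : Type :=
  {p : T * seq T | path e p.1 p.2}.

Definition plen (T : finType) (e : rel T) (g : gpath e) : nat :=
  size (val g).2.

Definition pinit (T : finType) (e : rel T) (g : gpath e) : T := (val g).1.

Definition pfinal (T : finType) (e : rel T) (g : gpath e) : T :=
  last (val g).1 (val g).2.

Definition pvertex (T : finType) (e : rel T) (g : gpath e) (i : nat) : T :=
  nth (val g).1 ((val g).1 :: (val g).2) i.

Definition traverses (T : finType) (e : rel T) (g : gpath e) (q r : T) : Prop :=
  exists i, [/\ (i < plen g)%N, pvertex g i = q & pvertex g i.+1 = r].

Definition paths_between (T : finType) (e : rel T) (a b : T) : set (gpath e) :=
  [set g | pinit g = a /\ pfinal g = b].
Arguments paths_between {T} e a b.

Definition is_flow (R : realType) (T : finType) (e : rel T)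
    (F : gpath e -> R) : Prop :=
  (forall g, 0 <= F g <= 1) /\
  (forall a b, (\esum_(g in paths_between e a b) (F g)%:E = 1)%E).

Definition averaged_extension (R : realType) (T : finType) (W : {set T})
    (P : T -> kept W -> R) (f : kept W -> R) : T -> R :=
  fun x => \sum_(y : kept W) P x y * f y.

(* The value may be +oo, and is -oo (the empty supremum) when no edge is left. *)
Definition congestion (R : realType) (T : finType) (e : rel T) (W : {set T})
    (P : T -> kept W -> R) (PP : T -> T -> kept W * kept W -> R)
    (F : gpath (removal_graph e W) -> R) : \bar R :=
  ereal_sup
    [set (1%:E
      + 2%:E * (\esum_(g in [set g : gpath (removal_graph e W)
                            | traverses g qr.1 qr.2])
                  ((plen g)%:R * F g * \sum_(y | y \in W) P y (pfinal g))%:E)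
      + (\esum_(g in [set g : gpath (removal_graph e W)
                     | traverses g qr.1 qr.2])
           (F g * (plen g)%:R *
            \sum_(xy : T * T | [&& e xy.1 xy.2, xy.1 \in W & xy.2 \in W])
              PP xy.1 xy.2 (pinit g, pfinal g))%:E))%E
    | qr in [set qr : kept W * kept W | removal_graph e W qr.1 qr.2]].

(* Main.v *)
Require Import Defs.
From mathcomp Require Import all_boot all_order all_algebra.
From mathcomp Require Import all_classical all_reals all_analysis.
From mathcomp Require Import ring lra.

Set Implicit Arguments.
Unset Strict Implicit.
Unset Printing Implicit Defensive.

Import Order.TTheory GRing.Theory Num.Theory.
Local Open Scope classical_set_scope.
Local Open Scope ring_scope.

(* Both Dirichlet forms are, up to constants, sums of squared increments over
   oriented edges.  An edge of the original graph with an endpoint in W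
   contributes, by Jensen's inequality, at most an average of
   (f a - f b)^2 over pairs (a, b) drawn from P_y or P_{x,y}; averaging further
   over the paths from a to b with weights F and applying Cauchy-Schwarz along
   each path bounds this by increments of f over edges of G.  Exchanging the
   sums collects, at each edge (q, r), exactly the load of (q, r) in the
   congestion. *)

(** * Cauchy-Schwarz for averages and along a path *)

(** Lagrange's identity: expanding the nonnegative double sum of [w i * w j * (u i - u j) ^+ 2]
    gives twice the right side minus the left. Probability weights yield Jensen; unit weights yield
    the bound along a path. *)
Lemma sqr_sum_le_weighted (R : realFieldType) (I : Type) (s : seq I)
    (w u : I -> R) : (forall i, 0 <= w i) ->
  (\sum_(i <- s) w i * u i) ^+ 2 <=
  (\sum_(i <- s) w i) * \sum_(i <- s) w i * u i ^+ 2.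
Proof.
move=> w0.
set A := \sum_(i <- s) w i; set B := \sum_(i <- s) _ * u _.
set C := \sum_(i <- s) _ * _ ^+ 2.
have : 0 <= \sum_(i <- s) \sum_(j <- s) w i * w j * (u i - u j) ^+ 2.
  apply: sumr_ge0 => i _; apply: sumr_ge0 => j _.
  by apply: mulr_ge0; [exact: mulr_ge0|exact: sqr_ge0].
have -> : \sum_(i <- s) \sum_(j <- s) w i * w j * (u i - u j) ^+ 2 =
    \sum_(i <- s) (A * (w i * u i ^+ 2) - 2 * B * (w i * u i) + C * w i).
  apply: eq_bigr => i _; rewrite /A /B /C mulr_sumr !mulr_suml -sumrB -big_split /=.
  by apply: eq_bigr => j _; ring.
rewrite big_split sumrB /= -!mulr_sumr -/A -/B -/C => H.
lra.
Qed.

Lemma sqr_dist_average_le (R : realType) (X : finType) (p g : X -> R)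
    (c : R) : is_pmf p ->
  (c - \sum_b p b * g b) ^+ 2 <= \sum_b p b * (c - g b) ^+ 2.
Proof.
move=> [p0 p1].
have -> : c - \sum_b p b * g b = \sum_b p b * (c - g b).
  under [RHS]eq_bigr do rewrite mulrBr.
  by rewrite sumrB -mulr_suml p1 mul1r.
by rewrite (le_trans (sqr_sum_le_weighted _ _ p0)) // p1 mul1r.
Qed.

(** Both means are integrals against the coupling [c], by its marginals, so their difference is a
    single mean of [g a - g b]. *)
Lemma sqr_dist_coupling_le (R : realType) (X : finType) (p q g : X -> R)
    (c : X * X -> R) : is_coupling p q c ->
  (\sum_a p a * g a - \sum_b q b * g b) ^+ 2 <=
  \sum_a \sum_b c (a, b) * (g a - g b) ^+ 2.
Proof.
move=> [[c0 c1] cp cq].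
have -> : \sum_a p a * g a - \sum_b q b * g b =
          \sum_ab c ab * (g ab.1 - g ab.2).
  under eq_bigr do rewrite -cp mulr_suml.
  under [X in _ - X]eq_bigr do rewrite -cq mulr_suml.
  rewrite [X in _ - X]exchange_big !pair_bigA -sumrB /=.
  by apply: eq_bigr => -[a b] _; rewrite mulrBr.
rewrite pair_bigA (le_trans (sqr_sum_le_weighted _ _ c0)) // c1 mul1r.
by apply: ler_sum => -[a b] _.
Qed.

(* The edge sum on the right ignores multiplicity, so a path that uses an edge
   several times is first shortened to one without repeated vertices. *)
Lemma sqr_dist_path_le (R : realFieldType) (V : finType) (e : rel V)
    (g : gpath e) (f : V -> R) :
  (f (pinit g) - f (pfinal g)) ^+ 2 <=
  (plen g)%:R * \sum_(qr | e qr.1 qr.2 && `[< traverses g qr.1 qr.2 >])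
                  (f qr.1 - f qr.2) ^+ 2.
Proof.
(* Shortening is done with respect to [t] rather than [e], so that the shortened path still uses
   only edges traversed by [g]. *)
pose t qr := e qr.1 qr.2 && `[< traverses g qr.1 qr.2 >].
have : path (fun q r => t (q, r)) (pinit g) (val g).2.
  apply/(pathP (pinit g)) => i ip; apply/andP; split.
    by have /(pathP (pinit g)) := valP g; apply.
  by apply/asboolP; exists i.
rewrite /pfinal /plen -/(pinit g); move: (pinit g) (val g).2 => x p.
case/shortenP => p' pt /= /andP[_ up'] p'p.
pose l := zip (x :: p') p'.
have lt : {in l, forall s, t s}.
  rewrite {}/l; elim: p' x pt {up' p'p} => //= y p' IH x /andP[txy pt] s.
  by rewrite inE => /predU1P[-> //|]; exact: IH.
(* The heads of the steps are the entries of [p'], which are distinct. *)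
have ul : uniq l.
  by apply: (@map_uniq _ _ snd); rewrite -/unzip2 unzip2_zip // leqnSn.
have sl : size l = size p' by rewrite size_zip; apply/minn_idPr/leqnSn.
have -> : f x - f (last x p') = \sum_(s <- l) 1 * (f s.1 - f s.2).
  rewrite /l; elim: p' x {pt up' p'p l lt ul sl} => /= [|y p' IH] x.
    by rewrite big_nil subrr.
  by rewrite big_cons /= -IH mul1r addrA subrK.
apply: le_trans (sqr_sum_le_weighted _ _ (fun=> ler01)) _.
rewrite big_const_seq count_predT sl iter_addr addr0.
rewrite [X in _ * X <= _](eq_bigr (fun s => (f s.1 - f s.2) ^+ 2)); last first.
  by move=> s _; rewrite mul1r.
apply: ler_pM => //; first by apply: sumr_ge0 => ? _; exact: sqr_ge0.
  by rewrite ler_nat uniq_leq_size.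
rewrite big_uniq //= [leRHS](bigID (mem l)) /= [X in _ <= X + _](_ : _ =
  \sum_(i in l) (f i.1 - f i.2) ^+ 2); last first.
  by apply: eq_bigl => s; rewrite -/(t s); case: (boolP (s \in l)) => [/lt ->|_]; rewrite ?andbF.
by rewrite lerDl; apply: sumr_ge0 => ? _; exact: sqr_ge0.
Qed.

(** * Unconditional sums over paths *)

Lemma ge0_esumZl (R : realType) (I : choiceType) (S : set I) (c : R)
    (a : I -> \bar R) : 0 <= c -> (forall i, 0 <= a i)%E ->
  (\esum_(i in S) (c%:E * a i) = c%:E * \esum_(i in S) a i)%E.
Proof.
move=> c0 a0; rewrite /esum -ereal_supZl //; last first.
  (* Scaling a supremum, in particular by 0, requires a nonempty set; the empty partial sum belongs
     to it. *)
  by apply/set0P; exists (\sum_(x \in set0) a x)%E, set0 => //; exact: fsets_set0.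
rewrite image_comp; congr ereal_sup; apply: eq_imagel => A _ /=.
by rewrite ge0_mule_fsumr.
Qed.

(** Applied with [w] the mass that removed vertices, or edges between them, put on the pair of
    endpoints. The right side may be infinite, hence the extended reals. *)
Lemma weighted_variation_le (R : realType) (V : finType) (e : rel V)
    (F : gpath e -> R) (w : V -> V -> R) (f : V -> R) :
  is_flow F -> (forall a b, 0 <= w a b) ->
  ((\sum_a \sum_b w a b * (f a - f b) ^+ 2)%:E <=
   \sum_(qr | e qr.1 qr.2) ((f qr.1 - f qr.2) ^+ 2)%:E *
     \esum_(g in [set g : gpath e | traverses g qr.1 qr.2])
       (F g * (plen g)%:R * w (pinit g) (pfinal g))%:E)%E.
Proof.
move=> [F01 F1] w0.
have F0 g : 0 <= F g by case/andP: (F01 g).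
have D0 a b : 0 <= w a b * (f a - f b) ^+ 2 by rewrite mulr_ge0 ?sqr_ge0.
pose h (g : gpath e) := (w (pinit g) (pfinal g) *
  (f (pinit g) - f (pfinal g)) ^+ 2 * F g)%:E.
have h0 g : (0 <= h g)%E by rewrite lee_fin mulr_ge0.
(* Paths are grouped by their endpoints; the flow has total mass 1 on each group, and every path
   lies in exactly one group. *)
have -> : ((\sum_a \sum_b w a b * (f a - f b) ^+ 2)%:E =
    \esum_(g in [set: gpath e]) h g)%E.
  rewrite pair_bigA -sumEFin.
  transitivity (\sum_(ab : V * V) \esum_(g in paths_between e ab.1 ab.2) h g)%E.
    apply: eq_bigr => -[a b] _ /=.
    rewrite -[LHS]mule1 -(F1 a b) -ge0_esumZl //.
    by apply: eq_esum => g [<- <-].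
  under eq_bigr do rewrite esum_mkcond.
  rewrite -esum_sum; last by move=> g ab _ _; case: ifP.
  apply: eq_esum => g _; rewrite -big_mkcond /= (big_pred1 (pinit g, pfinal g)) //.
  move=> [a b] /=; apply/idP/eqP => [|[-> ->]]; last exact: mem_set.
  by rewrite inE => -[-> ->].
under eq_bigr => qr _.
  rewrite esum_mkcond -ge0_esumZl ?sqr_ge0 //; last first.
    by move=> g; case: ifP => // _; rewrite lee_fin !mulr_ge0.
  over.
(* Tonelli: with the path sum outermost on both sides, it suffices to compare path by path. *)
rewrite -esum_sum; last first.
  move=> g qr _ _; apply: mule_ge0; first by rewrite lee_fin sqr_ge0.
  by case: ifP => // _; rewrite lee_fin !mulr_ge0.
apply: le_esum => g _.
under eq_bigr => qr _.
  rewrite (fun_if (fun x => _ * x)%E) mule0 -EFinM unfold_in /=; over.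
rewrite -big_mkcondr /= sumEFin lee_fin -mulr_suml.
rewrite [leLHS](_ : _ = (f (pinit g) - f (pfinal g)) ^+ 2 *
  (F g * w (pinit g) (pfinal g))); last by ring.
rewrite [leRHS](_ : _ = (plen g)%:R *
  (\sum_(qr | e qr.1 qr.2 && `[< traverses g qr.1 qr.2 >])
      (f qr.1 - f qr.2) ^+ 2) * (F g * w (pinit g) (pfinal g))).
  by rewrite ler_wpM2r ?mulr_ge0 ?sqr_dist_path_le.
by rewrite [X in _ = _ * X * _](eq_bigl _ _ (fun=> erefl)); ring.
Qed.

(** * Edge sums on the two graphs *)

Lemma sum_kept (V : nmodType) (T : finType) (W : {set T}) (G : T -> V) :
  \sum_(x | x \notin W) G x = \sum_(a : kept W) G (val a).
Proof.
rewrite (reindex_omap (val : kept W -> T) insub) /=; last by move=> x xW; rewrite insubT.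
by apply: eq_bigl => a; rewrite (valP a) valK eqxx.
Qed.

Lemma card_kept (T : finType) (W : {set T}) : (#|{: kept W}| + #|W| = #|T|)%N.
Proof.
by rewrite card_sig addnC -(cardC (mem W)).
Qed.

(** Increments vanish on the diagonal, where the two walks hold with different probabilities, so one
    formula serves both. *)
Lemma dirichlet_form_edges (R : realType) (X : finType) (e : rel X) (c : R)
    (P : X -> X -> R) (f : X -> R) : irreflexive e ->
  (forall x y, x != y -> P x y = if e x y then c else 0) ->
  dirichlet_form P (uniform_pmf R X) f =
  2^-1 * c / #|X|%:R * \sum_(xy | e xy.1 xy.2) (f xy.1 - f xy.2) ^+ 2.
Proof.
move=> eirr Pe; rewrite /dirichlet_form pair_bigA /= [in RHS]big_mkcond /=.
rewrite !mulr_sumr; apply: eq_bigr => -[x y] _ /=.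
rewrite real_normK ?num_real // /uniform_pmf.
have [->|xy] := eqVneq x y; first by rewrite eirr subrr expr0n /= !mul0r !mulr0.
by rewrite Pe //; case: ifP => _; ring.
Qed.

(** Oriented edges are split by how many endpoints lie in [W]; the factor 2 counts the two
    orientations of a mixed edge. *)
Lemma extension_variation_le (R : realType) (T : finType) (e : rel T)
    (W : {set T}) (P : T -> kept W -> R) (PP : T -> T -> kept W * kept W -> R)
    (f : kept W -> R) :
  symmetric e -> (forall x, is_pmf (P x)) ->
  (forall x y : kept W, P (val x) y = (y == x)%:R) ->
  (forall x y, e x y -> is_coupling (P x) (P y) (PP x y)) ->
  \sum_(xy | e xy.1 xy.2)
     (averaged_extension P f xy.1 - averaged_extension P f xy.2) ^+ 2 <=
  \sum_(ab | removal_graph e W ab.1 ab.2) (f ab.1 - f ab.2) ^+ 2 +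
  2 * \sum_a \sum_b (\sum_(y | y \in W) P y b) * (f a - f b) ^+ 2 +
  \sum_a \sum_b
    (\sum_(xy : T * T | [&& e xy.1 xy.2, xy.1 \in W & xy.2 \in W])
       PP xy.1 xy.2 (a, b)) * (f a - f b) ^+ 2.
Proof.
move=> esym P_pmf P_dirac PP_coupling.
set h := averaged_extension P f.
have hE a : h (val a) = f a.
  rewrite /h /averaged_extension (bigD1 a) //= P_dirac eqxx mul1r.
  by rewrite big1 ?addr0 // => b /negPf ba; rewrite P_dirac ba mul0r.
pose D (xy : T * T) := (h xy.1 - h xy.2) ^+ 2.
have D0 xy : 0 <= D xy by exact: sqr_ge0.
have DC x y : D (x, y) = D (y, x) by rewrite /D /= -sqrrN opprB.
pose cross := \sum_(xy : T * T | e xy.1 xy.2 && (xy.1 \notin W) && (xy.2 \in W)) D xy.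
have crossle : cross <= \sum_a \sum_b (\sum_(y | y \in W) P y b) * (f a - f b) ^+ 2.
  (* Adjacency is relaxed to all pairs of a kept and a removed vertex, matching the sum over all of
     [W] in the congestion. *)
  apply: (@le_trans _ _ (\sum_(x | x \notin W) \sum_(y | y \in W) D (x, y))).
    rewrite pair_big /= /cross [leLHS]big_mkcond [leRHS]big_mkcond /=.
    apply: ler_sum => -[x y] _ /=.
    by case: (e x y) => //=; case: ifP.
  rewrite sum_kept; apply: ler_sum => a _.
  under [leRHS]eq_bigr do rewrite mulr_suml.
  rewrite exchange_big /=; apply: ler_sum => y _.
  by rewrite /D /= hE; exact: sqr_dist_average_le.
have -> : \sum_(xy | e xy.1 xy.2) (h xy.1 - h xy.2) ^+ 2 =
    \sum_(xy : T * T | e xy.1 xy.2 && (xy.1 \notin W) && (xy.2 \notin W)) D xy +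
    2 * cross +
    \sum_(xy : T * T | [&& e xy.1 xy.2, xy.1 \in W & xy.2 \in W]) D xy.
  rewrite (bigID (fun xy => xy.1 \in W)) /= [X in X + _](bigID (fun xy => xy.2 \in W)) /=.
  rewrite [X in _ + X](bigID (fun xy => xy.2 \in W)) /=.
  rewrite -/cross.
  rewrite [X in _ + X + _ = _](_ : _ = cross); last first.
    have swapK : involutive (fun xy : T * T => (xy.2, xy.1)) by case.
    rewrite /cross (reindex_inj (inv_inj swapK)) /=.
    apply: eq_big => [[x y]|[x y] _]; last by rewrite -DC.
    by rewrite /= esym andbAC.
  rewrite [X in X + _ + _ = _](eq_bigl (fun xy => [&& e xy.1 xy.2, xy.1 \in W & xy.2 \in W])).
    by rewrite /D; ring.
  by move=> xy; rewrite andbA.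
apply: lerD; first apply: lerD.
- rewrite (_ : \sum_(_ | _) _ = \sum_(x | x \notin W) \sum_(y | y \notin W)
    if e x y then D (x, y) else 0); last first.
    rewrite pair_big /= -big_mkcondr; apply: eq_big => -[x y] //=.
    by rewrite -andbA andbC.
  rewrite sum_kept; under eq_bigr do rewrite sum_kept.
  rewrite pair_bigA /= -big_mkcond /=; apply: ler_sum => -[a b] _.
  by rewrite /D /= !hE.
- by rewrite ler_pM2l.
- under [leRHS]eq_bigr => a _.
    under eq_bigr do rewrite mulr_suml.
    rewrite exchange_big /=; over.
  rewrite exchange_big /=; apply: ler_sum => -[x y] /= /and3P[exy _ _].
  exact: sqr_dist_coupling_le (PP_coupling x y exy).
Qed.

(** * Comparison of the Dirichlet forms *)

Theorem theorem3 (R : realType) (T : finType) (e : rel T) (d n m : nat)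
    (W : {set T})
    (e_simple : simple_graph e) (e_regular : regular_graph e d)
    (cardT : #|T| = n) (cardW : #|W| = m)
    (G_connected : connected_graph (removal_graph e W))
    (P : T -> kept W -> R)
    (P_pmf : forall x, is_pmf (P x))
    (P_dirac : forall x y : kept W, P (val x) y = (y == x)%:R)
    (PP : T -> T -> kept W * kept W -> R)
    (PP_coupling : forall x y, e x y -> is_coupling (P x) (P y) (PP x y))
    (F : gpath (removal_graph e W) -> R)
    (F_flow : is_flow F)
    (f : kept W -> R) :
  ((dirichlet_form (lazy_walk R e d) (uniform_pmf R T) (averaged_extension P f))%:E <=
   ((n%:R - m%:R) / n%:R)%:E * congestion P PP F *
   (dirichlet_form (metropolis_walk R (removal_graph e W) d)
      (uniform_pmf R (kept W)) f)%:E)%E.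
Proof.
have [esym eirr] := e_simple.
rewrite (@dirichlet_form_edges _ _ e (2 * d%:R)^-1) //; last first.
  by move=> x y /negPf xy; rewrite /lazy_walk xy.
rewrite (@dirichlet_form_edges _ _ (removal_graph e W) (2 * d%:R)^-1); first last.
- by move=> x y /negPf xy; rewrite /metropolis_walk xy.
- by move=> x; exact: eirr.
have cardV : #|{: kept W}|%:R = n%:R - m%:R :> R.
  by rewrite -cardT -cardW -(card_kept W) natrD addrK.
have V0 : n%:R - m%:R != 0 :> R.
  by rewrite -cardV pnatr_eq0 -lt0n; case: G_connected.
rewrite cardT cardV; set A := congestion _ _ _.
set ST := \sum_(xy | _) _; set SV := \sum_(xy | _) _.
set c : R := 2^-1 * _.
have c0 : 0 <= c / n%:R by rewrite !mulr_ge0 ?invr_ge0 ?mulr_ge0.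
(* The forms share the factor [c], and the prefactor turns the normalisation by [n - m] into that by
   [n]; only the edge sums remain to be compared. *)
suff STle : (ST%:E <= A * SV%:E)%E.
  rewrite (muleC _ A) -muleA -EFinM.
  have -> : (n%:R - m%:R) / n%:R * (c / (n%:R - m%:R) * SV) = c / n%:R * SV.
    by move: V0; move: (n%:R - m%:R) (n%:R^-1 : R) => N i N0; field.
  by rewrite !EFinM muleCA; exact: lee_wpmul2l.
(* These weights produce the two path sums of the congestion. [wP] is constant in [a] because the
   kept end of a mixed edge ranges over all of V. *)
pose wP (a b : kept W) := \sum_(y | y \in W) P y b.
pose wPP (a b : kept W) :=
  \sum_(xy : T * T | [&& e xy.1 xy.2, xy.1 \in W & xy.2 \in W])
     PP xy.1 xy.2 (a, b).
have wP0 a b : 0 <= wP a b by apply: sumr_ge0 => y _; case: (P_pmf y).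
have wPP0 a b : 0 <= wPP a b.
  by apply: sumr_ge0 => -[x y] /and3P[/PP_coupling[[]]].
have F0 g : 0 <= F g by case: F_flow => /(_ g)/andP[].
pose load (w : kept W -> kept W -> R) (qr : kept W * kept W) :=
  (\esum_(g in [set g : gpath (removal_graph e W) | traverses g qr.1 qr.2])
     (F g * (plen g)%:R * w (pinit g) (pfinal g))%:E)%E.
have load0 w qr : (forall a b, 0 <= w a b) -> (0 <= load w qr)%E.
  by move=> w0; apply: esum_ge0 => g _; rewrite lee_fin !mulr_ge0.
have loadA qr : removal_graph e W qr.1 qr.2 ->
    (1 + 2%:E * load wP qr + load wPP qr <= A)%E.
  move=> eqr; apply: ereal_sup_ubound; exists qr => //.
  congr (1 + 2%:E * _ + _)%E; apply: eq_esum => g _.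
  by rewrite [X in (X * _)%:E]mulrC.
have STload : (ST%:E <= \sum_(qr | removal_graph e W qr.1 qr.2)
    ((f qr.1 - f qr.2) ^+ 2)%:E * (1 + 2%:E * load wP qr + load wPP qr))%E.
  apply: (@le_trans _ _ (_%:E)).
    by rewrite lee_fin; exact: extension_variation_le P_pmf P_dirac PP_coupling.
  rewrite !EFinD EFinM -/wP -/wPP.
  apply: le_trans (leeD (leeD (lexx _) (lee_wpmul2l _
    (weighted_variation_le f F_flow wP0))) (weighted_variation_le f F_flow wPP0)) _.
    by rewrite lee_fin.
  rewrite ge0_sume_distrr; last first.
    by move=> qr _; rewrite mule_ge0 ?load0 // lee_fin sqr_ge0.
  rewrite -sumEFin -!big_split /=; apply: lee_sum => qr _.
  rewrite ge0_muleDr ?load0 ?adde_ge0 ?mule_ge0 ?load0 ?lee_fin //.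
  rewrite ge0_muleDr ?mule_ge0 ?load0 ?lee_fin //.
  by rewrite mule1 [X in (_ + X + _)%E]muleCA.
(* If G has no edge, [A] is -oo, but both edge sums are empty and -oo times 0 is 0, so the
   comparison still holds. *)
apply: le_trans STload _; rewrite /SV -sumEFin ge0_sume_distrr; last first.
  by move=> qr _; rewrite lee_fin sqr_ge0.
apply: lee_sum => qr /loadA qrA; rewrite muleC.
by apply: lee_wpmul2r => //; rewrite lee_fin sqr_ge0.
Qed.
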